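(* Let $(E,\|\cdot\|_E)$, $(F,\|\cdot\|_F)$, $(G,\|\cdot\|_G)$ be real normed vector spaces, let $\|\cdot\|'_E$ and $\|\cdot\|'_F$ be semi-norms on $E$ and $F$ respectively, and let $\cdot : E\times F\to G$ be a product (bilinear map) such that for all $x\in E$, $y\in F$: $$\|x\cdot y\|_G\le \|x\|'_E\,\|y\|_F \quad\text{and}\quad \|x\cdot y\|_G\le \|x\|_E\,\|y\|'_F .$$ For $(x,y)\in E\times F$ set $\|(x,y)\|_{\ell^\infty}=\sup(\|x\|_E,\|y\|_F)$ and $\|(x,y)\|'_{\ell^\infty}=\sup(\|x\|'_E,\|y\|'_F)$. Let $C\ge e$, $\sigma>0$, $q>0$, and let $X\in E$, $Y\in F$ be two random vectors such that $(X,Y)\propto Ce^{-(\cdot/\sigma)^q}$ both in $(E\times F,\|\cdot\|_{\ell^\infty})$ and in $(E\times F,\|\cdot\|'_{\ell^\infty})$. Let $\mu=\sup(\mathbb E[\|X\|'_E],\mathbb E[\|Y\|'_F])$. Then there exist two constants $C'>0$ and $\sigma'>0$, respectively proportional to $C$ and $\sigma$ (with proportionality factors depending only on $q$), such that $$X\cdot Y\ \propto\ C'e^{-\left(\cdot/(\sigma'\mu)\right)^{q}}+C'e^{-\left(\cdot/\sigma'^2\right)^{q/2}}\quad\text{in } (G,\|\cdot\|_G).$$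
   Context: For a real random variable $W$ and a non-increasing function $\alpha:\mathbb R_+\to\mathbb R_+$ (values above $1$ are read as $1$), $W\propto\alpha$ means: for an independent copy $W'$ of $W$, $\mathbb P(|W-W'|\ge t)\le\alpha(t)$ for all $t>0$. For a random vector $Z$ in a vector space $V$ endowed with a (semi-)norm $N$, ''$Z\propto\alpha$ in $(V,N)$'' (Lipschitz concentration) means that $f(Z)\propto\alpha$ for every $f:V\to\mathbb R$ that is $1$-Lipschitz with respect to $N$. In $\alpha$, the dot stands for the argument $t$. A quotient $t/0$ with $t>0$ is read as $+\infty$ (and $e^{-\infty}=0$). *)

(* Defs.v *)
From HB Require Import structures.
From mathcomp Require Import all_boot all_order all_algebra.
From mathcomp Require Import sesquilinear.
From mathcomp Require Import all_classical all_reals all_analysis.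
Set Implicit Arguments.
Unset Strict Implicit.
Unset Printing Implicit Defensive.
Import Order.TTheory GRing.Theory Num.Theory.
Import numFieldNormedType.Exports.
Local Open Scope classical_set_scope.
Local Open Scope ring_scope.

Record seminorm (R : realType) (V : lmodType R) (N : V -> R) : Prop := Seminorm {
  seminorm_ge0 : forall x, 0 <= N x ;
  seminormD : forall x y, N (x + y) <= N x + N y ;
  seminormZ : forall (a : R) x, N (a *: x) = `|a| * N x }.

Definition linf_norm (R : realType) (U V : Type) (NU : U -> R) (NV : V -> R)
  (z : U * V) : R := Num.max (NU z.1) (NV z.2).

(* Measurability is with respect to the Borel sigma-algebra of V. *)
Definition random_vector (R : realType) (d : measure_display)
    (T : measurableType d) (V : normedModType R) (Z : T -> V) : Prop :=
  measurable_fun [set: T] (Z : T -> g_sigma_algebraType (@open V)).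

(* W \propto alpha.  On (T * T, P \x P), the variables w |-> W w.1 and
   w |-> W w.2 are W and an independent copy of W.  Since a probability is at
   most 1, values of alpha above 1 are not constraining, so alpha need not be
   truncated. *)
Definition concentrated (R : realType) (d : measure_display)
    (T : measurableType d) (P : probability T R) (W : T -> R)
    (alpha : R -> \bar R) : Prop :=
  measurable_fun [set: T] W /\
  forall t : R, 0 < t ->
    ((P \x P)%E [set w : T * T | (t <= `|W w.1 - W w.2|)%R] <= alpha t)%E.

(* Z \propto alpha in (V, N).  That each f \o Z is a real random variable is
   part of the notion (see concentrated): it follows from the measurability of
   Z when N is continuous, but a semi-norm N need not be. *)
Definition lipschitz_concentrated (R : realType) (d : measure_display)
    (T : measurableType d) (P : probability T R) (V : lmodType R) (N : V -> R)
    (Z : T -> V) (alpha : R -> \bar R) : Prop :=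
  forall f : V -> R, (forall x y, `|f x - f y| <= N (x - y)) ->
    concentrated P (f \o Z) alpha.

(* e^{-(t/s)^q}.  With extended reals, t / 0 = +oo for t > 0 and
   e^{-oo} = 0, so the value is 0 for s = 0, t > 0 and q > 0. *)
Definition exp_tail (R : realType) (q : R) (s : \bar R) (t : R) : \bar R :=
  expeR (- poweR (t%:E / s) q)%E.

(* Main.v *)
(* On the set where NE' x <= th and NF' y <= th, the map (x, y) |-> f (dot x y)
   is 2 th-Lipschitz for the sup norm, since
   x y - x' y' = (x - x') y + x' (y - y').
   Replace it by a McShane extension g: the increments of f (dot X Y) are those
   of g (X, Y), concentrated at scale 2 th sigma, unless X or Y (or its
   independent copy) leaves that set.  Markov's inequality applied to the
   independent copy gives P(W >= 2 m + 2 s) <= 2 alpha(s) for W = NE' X or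
   NF' Y, with no need to centre W.  Take th = 2 mu + 2 s with s = sqrt t: the
   exit probability is the second tail, and the Lipschitz part gives the first
   tail when s <= mu and the second one otherwise. *)
Require Import Defs.
From HB Require Import structures.
From mathcomp Require Import all_boot all_order all_algebra.
From mathcomp Require Import sesquilinear.
From mathcomp Require Import all_classical all_reals all_analysis.
From mathcomp Require Import measurable_realfun ring lra.
Set Implicit Arguments.
Unset Strict Implicit.
Unset Printing Implicit Defensive.
Import Order.TTheory GRing.Theory Num.Theory.
Import numFieldNormedType.Exports.
Local Open Scope classical_set_scope.
Local Open Scope ring_scope.

(** The McShane formula: an infimum over [a] in [A] of the functions [h a + N (x - a)], each
    1-Lipschitz in [x]. On [A], the term of the point itself gives one inequality and the Lipschitz
    bound of [h] the other. *)
Lemma lipschitz_extension (R : realType) (V : zmodType) (N : V -> R)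
    (A : set V) (h : V -> R) :
  (forall x y, N (x + y) <= N x + N y) -> (forall x, N (- x) = N x) ->
  N 0 = 0 ->
  A !=set0 -> (forall a b, A a -> A b -> `|h a - h b| <= N (a - b)) ->
  exists g : V -> R, (forall a, A a -> g a = h a) /\
    (forall x y, `|g x - g y| <= N (x - y)).
Proof.
move=> ND NN N0 [a0 Aa0] hA.
have Nle x y z : N (x - z) <= N (x - y) + N (y - z).
  by apply: le_trans (ND _ _); rewrite addrA subrK.
pose S x := [set h a + N (x - a) | a in A].
(* [inf] takes a default value on a set that is empty or unbounded below; both cases are excluded
   first. *)
have S_lb x : lbound (S x) (h a0 - N (x - a0)).
  move=> _ [a Aa <-]; have := hA _ _ Aa0 Aa; have := Nle a0 x a.
  rewrite -(opprB x a0) NN ler_norml; lra.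
have S0 x : S x !=set0 by exists (h a0 + N (x - a0)); exists a0.
have Shi x : has_lbound (S x) by exists (h a0 - N (x - a0)).
have g_le x y : inf (S x) - inf (S y) <= N (x - y).
  rewrite lerBlDr -lerBlDl; apply: lb_le_inf => // _ [a Aa <-].
  rewrite lerBlDl; apply: (@le_trans _ _ (h a + N (x - a))).
    by apply: ge_inf => //; exists a.
  by have := Nle x y a; lra.
exists (fun x => inf (S x)); split=> [a Aa|x y].
  apply/eqP; rewrite eq_le; apply/andP; split.
    suff -> : h a = h a + N (a - a) by apply: ge_inf => //; exists a.
    by rewrite subrr N0 addr0.
  apply: lb_le_inf => // _ [b Ab <-].
  by have := hA _ _ Aa Ab; rewrite ler_norml; lra.
have := g_le x y; have := g_le y x; rewrite -(opprB x y) NN ler_norml; lra.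
Qed.

(** * Gaps between independent copies, and upper tails *)

Lemma measurable_gap (R : realType) (d : measure_display)
    (T : measurableType d) (W : T -> R) (t : R) : measurable_fun [set: T] W ->
  measurable [set w : T * T | t <= `|W w.1 - W w.2|].
Proof.
move=> mW; rewrite -[X in measurable X]setTI; apply: measurable_fun_le => //.
by apply: measurableT_comp => //; apply: measurable_funB;
  exact: measurableT_comp.
Qed.

Lemma concentrated_upper_tail (R : realType) (d : measure_display)
    (T : measurableType d) (P : probability T R) (W : T -> R)
    (alpha : R -> \bar R) (m s : R) :
  (forall w, 0 <= W w) -> ('E_P[W] <= m%:E)%E -> concentrated P W alpha ->
  0 < s -> (P [set w | (2 * m + 2 * s <= W w)%R] <= 2%:E * alpha s)%E.
Proof.
move=> W0 EW [mW cW] s0.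
have m0 : 0 <= m by rewrite -lee_fin (le_trans _ EW)// expectation_ge0.
set A := [set w | _]; pose B := [set w | 2 * m + s <= W w].
have mS r : measurable [set w | r <= W w].
  by rewrite -[X in measurable X]setTI; apply: measurable_fun_le.
(* Markov's inequality at level [2 * m + s]: the summand [s] keeps the level positive even when
   [m = 0]. *)
have PB : (P B <= (1 / 2)%:E)%E.
  have e0 : 0 < 2 * m + s by lra.
  have : ((2 * m + s)%:E * P B <= m%:E)%E.
    have := @le_integral_comp_abse _ _ _ P _ measurableT (EFin \o W)
      (2 * m + s) id (@measurable_id _ _ _) (fun _ => id) (fun _ _ _ _ => id)
      ((measurable_EFinP _ _).2 mW) e0.
    rewrite setTI.
    have -> : [set x | ((2 * m + s)%:E <= `|(EFin \o W) x|)%E] = B.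
      by apply/seteqP; split=> w /=; rewrite lee_fin ger0_norm.
    move/le_trans; apply; apply: le_trans EW; rewrite unlock.
    by under eq_integral => w _ do rewrite /= ger0_norm//.
  have /fineK <- : P B \is a fin_num by apply: fin_num_measure; exact: mS.
  rewrite -EFinM !lee_fin => h.
  rewrite -(ler_pM2l e0); lra.
have PBC : ((1 / 2)%:E <= P (~` B))%E.
  rewrite probability_setC; last exact: mS.
  have PBf : P B \is a fin_num by apply: fin_num_measure; exact: mS.
  move: PB; rewrite -(fineK PBf) -EFinB !lee_fin; lra.
have: ((P \x P)%E (A `*` ~` B) <= alpha s)%E.
  apply: le_trans (cW _ s0); apply: le_measure; rewrite ?inE.
  - by apply: measurableX; [exact: mS | apply: measurableC; exact: mS].
  - exact: measurable_gap.
  move=> [w1 w2] [] /=; rewrite /A /B /= => h1 /negP; rewrite -ltNge => h2.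
  by apply: le_trans (ler_norm _); lra.
rewrite product_measure1E; [|exact: mS|apply: measurableC; exact: mS].
move=> h.
apply: (@le_trans _ _ (2%:E * (P A * P (~` B)))%E); last first.
  by rewrite lee_pmul2l.
rewrite muleCA -[leLHS]mule1 lee_wpmul2l//.
apply: (@le_trans _ _ (2%:E * (1/2)%:E)%E); last by rewrite lee_pmul2l.
rewrite -EFinM lee_fin; lra.
Qed.

(** * Values and comparison of the tails *)

Lemma exp_tail_ge0 (R : realType) (q : R) (s : \bar R) (t : R) :
  (0 <= exp_tail q s t)%E.
Proof. exact: expeR_ge0. Qed.

Lemma exp_tail_EFin (R : realType) (q s t : R) : 0 < s ->
  exp_tail q s%:E t = (expR (- (t / s) `^ q))%:E.
Proof. by move=> s0; rewrite /exp_tail inver gt_eqF. Qed.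

Lemma exp_tail_pinfty (R : realType) (q t : R) : 0 < q ->
  exp_tail q +oo%E t = 1%E.
Proof.
by move=> q0; rewrite /exp_tail invey mule0 /= powR0 ?gt_eqF// oppr0 expR0.
Qed.

Lemma le_exp_tail (R : realType) (q s s' t t' : R) : 0 < q -> 0 < s ->
  0 < s' -> 0 <= t' -> t' / s' <= t / s ->
  (exp_tail q s%:E t <= exp_tail q s'%:E t')%E.
Proof.
move=> q0 s0 s'0 t'0 h; rewrite !exp_tail_EFin// lee_fin ler_expR lerN2.
have h0 : 0 <= t' / s' by rewrite divr_ge0// ltW.
by apply: ge0_ler_powR; rewrite ?nnegrE ?(ltW q0)//; exact: le_trans h.
Qed.

(** Turns a tail of exponent [q] taken at the square root of the argument into the second tail of
    the theorem. *)
Lemma exp_tail_sqr (R : realType) (q s t : R) : 0 < s -> 0 <= t ->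
  exp_tail (q / 2) (s ^+ 2)%:E (t ^+ 2) = exp_tail q s%:E t.
Proof.
move=> s0 t0; rewrite !exp_tail_EFin ?exprn_gt0//.
have ts0 : 0 <= t / s by rewrite divr_ge0// ltW.
rewrite -expr_div_n -powR_mulrn// -powRrM; congr (expR (- _ `^ _))%:E.
by field.
Qed.

(** * Semi-norms and truncation of the product *)

Lemma linf_norm_seminorm (R : realType) (U V : lmodType R) (NU : U -> R)
    (NV : V -> R) :
  seminorm NU -> seminorm NV -> seminorm (linf_norm NU NV : U * V -> R).
Proof.
move=> [NU0 NUD NUZ] [NV0 NVD NVZ]; split=> [x|x y|a x]; rewrite /linf_norm/=.
- by rewrite le_max NU0.
- rewrite ge_max; apply/andP; split.
    by apply: le_trans (NUD _ _) _; apply: lerD; rewrite le_max lexx.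
  by apply: le_trans (NVD _ _) _; apply: lerD; rewrite le_max lexx orbT.
- by rewrite NUZ NVZ maxr_pMr.
Qed.

Lemma seminorm0 (R : realType) (V : lmodType R) (N : V -> R) :
  seminorm N -> N 0 = 0.
Proof. by case=> _ _ NZ; rewrite -(scale0r 0) NZ normr0 mul0r. Qed.

Lemma seminormN (R : realType) (V : lmodType R) (N : V -> R) (x : V) :
  seminorm N -> N (- x) = N x.
Proof. by case=> _ _ NZ; rewrite -scaleN1r NZ normrN1 mul1r. Qed.

Lemma seminorm_norm (R : realType) (V : normedModType R) :
  seminorm (fun x : V => `|x|).
Proof. by split=> *; [exact: normr_ge0|exact: ler_normD|exact: normrZ]. Qed.

Lemma seminorm_lipschitz (R : realType) (V : lmodType R) (N : V -> R)
    (x y : V) : seminorm N -> `|N x - N y| <= N (x - y).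
Proof.
move=> sN; have [_ ND _] := sN.
have := ND (x - y) y; have := ND (y - x) x; rewrite !subrK.
by rewrite -(opprB x y) seminormN// ler_norml; lra.
Qed.

(** The Lipschitz constant [2 * th] is factored out so that [g] is 1-Lipschitz and can be fed
    directly to the concentration hypothesis. *)
Lemma truncated_product_extension (R : realType) (E F G : normedModType R)
    (NE' : E -> R) (NF' : F -> R) (dot : {bilinear E -> F -> G})
    (f : G -> R) (th : R) :
  seminorm NE' -> seminorm NF' ->
  (forall x y, `|dot x y| <= NE' x * `|y|) ->
  (forall x y, `|dot x y| <= `|x| * NF' y) ->
  (forall x y, `|f x - f y| <= `|x - y|) -> 0 < th ->
  exists g : E * F -> R,
    (forall x y, NE' x <= th -> NF' y <= th -> f (dot x y) = 2 * th * g (x, y))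
    /\ forall z z', `|g z - g z'| <=
        linf_norm (fun x : E => `|x|) (fun y : F => `|y|) (z - z').
Proof.
move=> sE sF dotE dotF f1 th0.
set N := linf_norm _ _.
have sN : seminorm N by apply: linf_norm_seminorm; exact: seminorm_norm.
have th20 : 0 < 2 * th by lra.
have [|x|||a b [aE aF] [bE bF]|g [gA gN]] := @lipschitz_extension R (E * F)%type
  N [set z | NE' z.1 <= th /\ NF' z.2 <= th]
  (fun z => f (dot z.1 z.2) / (2 * th)).
- by case: sN.
- exact: seminormN.
- exact: seminorm0.
- by exists 0; rewrite /= !seminorm0//; split; exact: ltW.
- rewrite -mulrBl normrM [X in _ * X]ger0_norm ?invr_ge0 ?(ltW th20)//.
  rewrite ler_pdivrMr//; apply: le_trans (f1 _ _) _.
  have -> : dot a.1 a.2 - dot b.1 b.2 =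
      dot (a.1 - b.1) a.2 + dot b.1 (a.2 - b.2).
    by rewrite linearBl linearBr addrA subrK.
  apply: le_trans (ler_normD _ _) _.
  have -> : N (a - b) * (2 * th) = N (a - b) * th + th * N (a - b) by ring.
  (* Each product bound is used so that the semi-norm falls on the truncated factor: [dotF] on
     [a.2], then [dotE] on [b.1]. *)
  apply: lerD.
    apply: le_trans (dotF _ _) _; apply: ler_pM => //.
      by case: sF.
    by rewrite /N /linf_norm le_max lexx.
  apply: le_trans (dotE _ _) _; apply: ler_pM => //.
    by case: sE.
  by rewrite /N /linf_norm le_max lexx orbT.
exists g; split=> // x y xth yth.
by rewrite gA//= mulrCA divff ?mulr1// gt_eqF.
Qed.

(** The two gaps can differ only on the strips [B]*[setT] and [setT]*[B], each of product measure
    [P B]. *)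
Lemma gap_le_off_event (R : realType) (d : measure_display)
    (T : measurableType d) (P : probability T R) (U V : T -> R) (B : set T)
    (t : R) :
  measurable_fun [set: T] U -> measurable_fun [set: T] V -> measurable B ->
  (forall w, ~ B w -> U w = V w) ->
  ((P \x P) [set w : T * T | (t <= `|U w.1 - U w.2|)%R] <=
   (P \x P) [set w : T * T | (t <= `|V w.1 - V w.2|)%R] + 2%:E * P B)%E.
Proof.
move=> mU mV mB UV.
set GU := [set w | _]; set GV := [set w | _].
have mGU : measurable GU by exact: measurable_gap.
have mGV : measurable GV by exact: measurable_gap.
have mBT : measurable (B `*` [set: T]) by exact: measurableX.
have mTB : measurable ([set: T] `*` B) by exact: measurableX.
apply: (@le_trans _ _ ((P \x P) (GV `|` (B `*` setT `|` setT `*` B)))%E).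
  apply: le_measure; rewrite ?inE//.
    by apply: measurableU => //; exact: measurableU.
  move=> [w1 w2]; rewrite /GU /GV /= => h.
  have [B1|B1] := pselect (B w1); first by right; left.
  have [B2|B2] := pselect (B w2); first by right; right.
  by left; rewrite -!UV.
apply: le_trans (measureU2 _ _ _) _ => //; first exact: measurableU.
rewrite leeD2l//; apply: le_trans (measureU2 _ _ _) _ => //.
rewrite mule_natl mule2n; apply: leeD.
  by have /= -> := product_measure1E P P mB measurableT;
    rewrite probability_setT mule1.
by have /= -> := product_measure1E P P measurableT mB;
  rewrite probability_setT mul1e.
Qed.

(* The Borel sets of a non-separable E * F need not be generated by rectangles,
   so measurability is not deduced from that of X and Y: f (dot X Y) is the
   pointwise limit of the extensions truncated at th = n + 1. *)
Lemma product_measurable (R : realType) (E F G : normedModType R)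
    (NE' : E -> R) (NF' : F -> R) (dot : {bilinear E -> F -> G})
    (d : measure_display) (T : measurableType d) (X : T -> E) (Y : T -> F)
    (f : G -> R) :
  seminorm NE' -> seminorm NF' ->
  (forall x y, `|dot x y| <= NE' x * `|y|) ->
  (forall x y, `|dot x y| <= `|x| * NF' y) ->
  (forall g : E * F -> R, (forall z z', `|g z - g z'| <=
      linf_norm (fun x : E => `|x|) (fun y : F => `|y|) (z - z')) ->
    measurable_fun [set: T] (fun w => g (X w, Y w))) ->
  (forall x y, `|f x - f y| <= `|x - y|) ->
  measurable_fun [set: T] (fun w => f (dot (X w) (Y w))).
Proof.
move=> sE sF dotE dotF mZ f1.
have /choice[g gP] n := truncated_product_extension sE sF dotE dotF f1
  (ltr0Sn R n).
apply: (@measurable_fun_cvg _ _ _ _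
  (fun n w => 2 * n.+1%:R * g n (X w, Y w))) => [n|w _].
  by apply: measurable_funM => //; apply: mZ; case: (gP n).
apply: cvg_near_cst.
(* From this rank on, the level [n.+1] dominates both semi-norms at [w], so the sequence is
   constant. *)
exists (Num.truncn (NE' (X w) + NF' (Y w))) => // n /= wn.
have [gE _] := gP n.
have wn1 : NE' (X w) + NF' (Y w) <= n.+1%:R.
  apply: le_trans (ltW (Num.Theory.truncnS_gt _)) _.
  by rewrite ler_nat ltnS.
have := seminorm_ge0 sE (X w); have := seminorm_ge0 sF (Y w).
by move=> ? ?; rewrite gE//; lra.
Qed.

(** * Assembly of the two tails *)

Theorem theorem2p28 (R : realType) (q : R) (q_gt0 : 0 < q) :
  exists kC ks : R, 0 < kC /\ 0 < ks /\
  forall (E F G : normedModType R) (NE' : E -> R) (NF' : F -> R)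
    (dot : {bilinear E -> F -> G})
    (d : measure_display) (T : measurableType d) (P : probability T R)
    (X : T -> E) (Y : T -> F) (C sigma : R),
  seminorm NE' -> seminorm NF' ->
  (forall x y, `|dot x y| <= NE' x * `|y|) ->
  (forall x y, `|dot x y| <= `|x| * NF' y) ->
  expR 1 <= C -> 0 < sigma ->
  random_vector X -> random_vector Y ->
  lipschitz_concentrated P (linf_norm (fun x : E => `|x|) (fun y : F => `|y|))
    (fun w => (X w, Y w)) (fun t => C%:E * exp_tail q sigma%:E t)%E ->
  lipschitz_concentrated P (linf_norm NE' NF')
    (fun w => (X w, Y w)) (fun t => C%:E * exp_tail q sigma%:E t)%E ->
  let mu := maxe ('E_P[fun w => NE' (X w)])%E ('E_P[fun w => NF' (Y w)])%E in
  let C' := kC * C in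
  let sigma' := ks * sigma in
  lipschitz_concentrated P (fun z : G => `|z|) (fun w => dot (X w) (Y w))
    (fun t => C'%:E * exp_tail q (sigma'%:E * mu) t
            + C'%:E * exp_tail (q / 2) (sigma' ^+ 2)%:E t)%E.
Proof.
(* The scale factor 8 comes from [2 * th = 4 * (m + s)], at most 8 times the larger of [m] and [s].
   The factor 9 is 1 for the Lipschitz part plus 8 for the exit: two copies, two semi-norms, and the
   2 of the upper tail bound. *)
exists 9, 8; split; first by []; split; first by [].
move=> E F G NE' NF' dot d T P X Y C sigma sE sF dotE dotF C_ge sigma0 _ _.
move=> cZ cZ' mu C' sigma' f f1.
have C1 : 1 <= C by apply: le_trans C_ge; rewrite -expR0 ler_expR.
have C0 : 0 < C by lra.
have C'0 : 0 < C' by rewrite /C'; lra.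
have mW : measurable_fun [set: T] (fun w => f (dot (X w) (Y w))).
  by apply: (product_measurable sE sF dotE dotF) f1 => g /cZ[].
split=> // t t0.
have cE : concentrated P (fun w => NE' (X w))
    (fun t => C%:E * exp_tail q sigma%:E t)%E.
  apply: (cZ' (fun z => NE' z.1)) => x y.
  by apply: le_trans (seminorm_lipschitz _ _ sE) _; rewrite le_max lexx.
have cF : concentrated P (fun w => NF' (Y w))
    (fun t => C%:E * exp_tail q sigma%:E t)%E.
  apply: (cZ' (fun z => NF' z.2)) => x y.
  by apply: le_trans (seminorm_lipschitz _ _ sF) _; rewrite le_max lexx orbT.
have tail0 r u : (0 <= C'%:E * exp_tail r u t)%E.
  by rewrite mule_ge0 ?exp_tail_ge0// lee_fin ltW.
have EmE : ('E_P[fun w => NE' (X w)] <= mu)%E by rewrite /mu le_max lexx.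
have EmF : ('E_P[fun w => NF' (Y w)] <= mu)%E by rewrite /mu le_max lexx orbT.
have mu0 : (0 <= mu)%E.
  by apply: le_trans EmE; apply: expectation_ge0 => w; case: sE.
(* For an infinite mean the first tail is the constant [C'], which is at least 1 and so bounds any
   probability. *)
case: mu mu0 EmE EmF tail0 => [m| |] // m0 EmE EmF tail0; last first.
  apply: (@le_trans _ _ 1%E).
    by apply: probability_le1; exact: measurable_gap.
  have -> : (sigma'%:E * +oo)%E = +oo%E by rewrite gt0_muley// lte_fin mulr_gt0.
  rewrite exp_tail_pinfty// mule1; apply: lee_paddr => //.
  by rewrite lee_fin /C'; lra.
have {}m0 : 0 <= m by [].
pose s := Num.sqrt t.
have s0 : 0 < s by rewrite sqrtr_gt0.
have s2 : s ^+ 2 = t by rewrite sqr_sqrtr// ltW.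
pose th := 2 * m + 2 * s.
have th0 : 0 < th by rewrite /th; lra.
have D0 : 0 < 2 * th by rewrite mulr_gt0.
have [g [gE gN]] := truncated_product_extension sE sF dotE dotF f1 th0.
pose B := [set w | th <= NE' (X w)] `|` [set w | th <= NF' (Y w)].
have mle (W : T -> R) : measurable_fun [set: T] W ->
    measurable [set w | th <= W w].
  by move=> ?; rewrite -[X in measurable X]setTI; exact: measurable_fun_le.
have mBE := mle _ cE.1; have mBF := mle _ cF.1.
pose alpha := (C%:E * exp_tail q sigma%:E s)%E.
have PB : (P B <= 4%:E * alpha)%E.
  apply: le_trans (measureU2 _ mBE mBF) _.
  have -> : (4%:E * alpha = 2%:E * alpha + 2%:E * alpha)%E.
    by rewrite /alpha exp_tail_EFin// -!EFinM -EFinD; congr EFin; ring.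
  apply: leeD.
    by apply: (concentrated_upper_tail _ EmE cE s0) => w; case: sE.
  by apply: (concentrated_upper_tail _ EmF cF s0) => w; case: sF.
have [mg cg] := cZ g gN.
apply: (@le_trans _ _ (C%:E * exp_tail q sigma%:E (t / (2 * th))
    + 2%:E * (4%:E * alpha))%E).
  apply: le_trans (@gap_le_off_event _ _ _ P _
    (fun w => 2 * th * g (X w, Y w)) B t mW _ _ _) _.
  - exact: measurable_funM.
  - exact: measurableU.
  - move=> w /not_orP[/negP]; rewrite -ltNge => hE /negP.
    by rewrite -ltNge => hF; apply: gE; exact: ltW.
  apply: leeD; last by rewrite lee_pmul2l.
  apply: le_trans _ (cg _ (divr_gt0 t0 D0)).
  apply: le_measure; rewrite ?inE; [|exact: measurable_gap|].
    by apply: (@measurable_gap _ _ _ (fun w => 2 * th * g (X w, Y w)));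
      exact: measurable_funM.
  move=> w /=; rewrite -mulrBr normrM (ger0_norm (ltW D0)).
  by rewrite ler_pdivrMr// mulrC.
have s8 : 0 < 8 * sigma by lra.
have t_ge0 := ltW t0.
(* Since [s] is the square root of [t], [alpha] is the second tail at scale [sigma], here enlarged
   to [sigma']. *)
have alpha_le : (alpha <= C%:E * exp_tail (q / 2) (sigma' ^+ 2)%:E t)%E.
  rewrite lee_pmul2l// -s2 exp_tail_sqr ?(ltW s0)//; apply: le_exp_tail => //.
    exact: ltW.
  by rewrite ler_pM2l// lef_pV2 ?posrE//; rewrite /sigma'; lra.
have thE : 2 * th = 4 * (m + s) by rewrite /th; ring.
have ratioE : t / (2 * th) / sigma = t / (2 * th * sigma).
  by rewrite -mulrA -invfM.
have main : (C%:E * exp_tail q sigma%:E (t / (2 * th)) <=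
    C%:E * exp_tail q (sigma'%:E * m%:E) t
    + C%:E * exp_tail (q / 2) (sigma' ^+ 2)%:E t)%E.
  have Ctail0 r u : (0 <= C%:E * exp_tail r u t)%E.
    by rewrite mule_ge0 ?exp_tail_ge0// lee_fin ltW.
  (* If [s <= m], then [m] is positive and [2 * th <= 8 * m] gives the first tail. Otherwise
     [2 * th <= 8 * s] and [t = s ^+ 2] bound the ratio below by [s / sigma'], which gives the
     second; there [m] may vanish, and only the sign of the first tail is used. *)
  have [sm|ms] := leP s m.
    have m_gt0 : 0 < m by exact: lt_le_trans sm.
    apply: lee_paddr => //; rewrite lee_pmul2l// -EFinM.
    apply: le_exp_tail => //; first by rewrite !mulr_gt0.
    rewrite ratioE ler_pM2l// lef_pV2 ?posrE ?mulr_gt0// /sigma' [leRHS]mulrAC.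
    by rewrite ler_pM2r// thE; lra.
  apply: lee_paddl => //; rewrite lee_pmul2l// -s2 exp_tail_sqr ?(ltW s0)//.
  apply: le_exp_tail => //; first exact: ltW.
  rewrite s2 ratioE -s2 expr2 -(mulrA s s) ler_pM2l//.
  rewrite ler_pdivlMr ?mulr_gt0// mulrC ler_pdivrMr//.
  by rewrite /sigma' mulrA ler_pM2r// thE; lra.
apply: (@le_trans _ _ ((C%:E * exp_tail q (sigma'%:E * m%:E) t
    + C%:E * exp_tail (q / 2) (sigma' ^+ 2)%:E t)
    + 8%:E * (C%:E * exp_tail (q / 2) (sigma' ^+ 2)%:E t))%E).
  apply: leeD => //; rewrite [leLHS]muleA -EFinM (_ : 2 * 4 = 8); last by ring.
  by rewrite lee_pmul2l.
rewrite -addeA; apply: leeD.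
  by apply: lee_wpmul2r; rewrite ?exp_tail_ge0// lee_fin /C'; lra.
by rewrite exp_tail_EFin ?exprn_gt0// -!EFinM -EFinD lee_fin /C'; lra.
Qed.
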